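(* For every $d\in\mathbb{N}$, $d\ge 1$, there is a constant $K_d>0$ depending only on $d$ such that the following holds. Let $M\geq 1$, let $t_1,\ldots,t_M\in[0,1)^d$ be pairwise different, let $c_1,\ldots,c_M\in\mathbb{C}\setminus\{0\}$, and let $z_j$ ($j=1,\ldots,M$), $T$, $T_1,\ldots,T_d$, and $S_1,\ldots,S_d$ be defined from these data and from $n\in\mathbb{N}$ as in the context. If $$n\geq \frac{K_d}{\min_{i\neq j}\|z_i-z_j\|},$$ then $T$ has rank $M$, and (for any choice of the reduced singular value decomposition of $T$ used in their definition) the matrices $S_1,\ldots,S_d$ are simultaneously diagonalizable. Furthermore, for any invertible matrix $W\in\mathbb{C}^{M\times M}$ that simultaneously diagonalizes $S_1,\ldots,S_d$ (that is, $W^{-1}S_\ell W$ is diagonal for every $\ell=1,\ldots,d$) there is a permutation $\tau$ of $\{1,\ldots,M\}$ such that $$W^{-1}S_\ell W=\operatorname{diag}\big(\langle z_{\tau(1)},e_\ell\rangle,\ldots,\langle z_{\tau(M)},e_\ell\rangle\big),\qquad \ell=1,\ldots,d.$$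
   Context: Notation: $\langle x,y\rangle=\sum_{\ell=1}^d x_\ell\overline{y_\ell}$ is the standard inner product on $\mathbb{C}^d$ (linear in the first argument), $\|\cdot\|$ the Euclidean norm, and $e_1,\ldots,e_d$ the standard basis vectors, so $\langle z,e_\ell\rangle$ is the $\ell$-th entry of $z$. A star denotes the conjugate transpose. Given pairwise different $t_1,\ldots,t_M\in[0,1)^d$ and nonzero $c_1,\ldots,c_M\in\mathbb{C}$, put $$z_j:=(e^{-2\pi i t_{j,1}},\ldots,e^{-2\pi i t_{j,d}})\in\mathbb{C}^d,\qquad f(k):=\sum_{j=1}^M c_j e^{-2\pi i\langle t_j,k\rangle},\quad k\in\mathbb{Z}^d.$$ For $n\in\mathbb{N}$ let $I_n:=\{0,\ldots,n\}^d$ with a fixed ordering of its elements, let $N:=\#I_n=(n+1)^d$, and define the $N\times N$ matrices $$T:=(f(k-l))_{k,l\in I_n},\qquad T_\ell:=(f(k-l+e_\ell))_{k,l\in I_n},\quad \ell=1,\ldots,d.$$ If $T$ has rank $M$, let $T=U\Sigma V^*$ be a reduced singular value decomposition, where $\Sigma\in\mathbb{R}^{M\times M}$ is diagonal and positive definite and $U,V\in\mathbb{C}^{N\times M}$ satisfy $U^*U=V^*V=\mathrm{id}_{M\times M}$. Then define the $M\times M$ matrices $$S_\ell:=U^*T_\ell V\Sigma^{-1},\qquad \ell=1,\ldots,d.$$ For $M=1$ the minimum over the empty set is read as $+\infty$, so that the condition on $n$ is vacuous. *)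

(* Defs.v *)
From HB Require Import structures.
From mathcomp Require Export all_boot all_order all_algebra.
From mathcomp Require Export fingroup perm.
From mathcomp Require Export classical_sets reals ereal topology normedtype trigo.
From mathcomp Require Export complex.

Set Implicit Arguments.
Unset Strict Implicit.
Unset Printing Implicit Defensive.

Export Order.TTheory GRing.Theory Num.Theory.

#[global] Open Scope ring_scope.
#[global] Open Scope complex_scope.
#[global] Open Scope sesquilinear_scope.

(* e^(- 2 pi i x) *)
Definition expim2pi (R : realType) (x : R) : R[i] :=
  cos (2 * pi * x) -i* sin (2 * pi * x).

Definition enorm (R : realType) (d : nat) (x : 'rV[R[i]]_d) : R :=
  Num.sqrt (complex.Re (dotmx x x)).

Definition node (R : realType) (d : nat) (t : 'rV[R]_d) : 'rV[R[i]]_d :=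
  \row_l expim2pi (t 0 l).

(* Its value is +oo when M <= 1, where there is no pair i != j. *)
Definition separation (R : realType) (d M : nat) (t : 'I_M -> 'rV[R]_d) :
    \bar R :=
  \big[Order.min/+oo%E]_(p : 'I_M * 'I_M | p.1 != p.2)
    (enorm (node (t p.1) - node (t p.2)))%:E.

Definition expsum (R : realType) (d M : nat) (t : 'I_M -> 'rV[R]_d)
    (c : 'I_M -> R[i]) (k : 'rV[int]_d) : R[i] :=
  \sum_(j < M) c j * expim2pi (\sum_(l < d) t j 0 l * (k 0 l)%:~R).

(* A finite function k : 'I_d -> 'I_n.+1 is an element of {0, ..., n}^d. *)
Definition gridv (d n : nat) (k : {ffun 'I_d -> 'I_n.+1}) : 'rV[int]_d :=
  \row_l Posz (k l).

(* s is the chosen ordering of {0, ..., n}^d. *)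
Definition Tmx (R : realType) (d M n : nat)
    (s : 'I_(n.+1 ^ d) -> {ffun 'I_d -> 'I_n.+1})
    (t : 'I_M -> 'rV[R]_d) (c : 'I_M -> R[i]) : 'M[R[i]]_(n.+1 ^ d) :=
  \matrix_(a, b) expsum t c (gridv (s a) - gridv (s b)).

Definition Tshift (R : realType) (d M n : nat)
    (s : 'I_(n.+1 ^ d) -> {ffun 'I_d -> 'I_n.+1})
    (t : 'I_M -> 'rV[R]_d) (c : 'I_M -> R[i]) (l : 'I_d) :
    'M[R[i]]_(n.+1 ^ d) :=
  \matrix_(a, b) expsum t c (gridv (s a) - gridv (s b) + delta_mx 0 l).

Definition posdefmx (R : realType) (m : nat) (A : 'M[R]_m) : Prop :=
  A^T = A /\ forall x : 'cV[R]_m, x != 0 -> 0 < (x^T *m A *m x) 0 0.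

Definition complexmx (R : realType) (m n : nat) (A : 'M[R]_(m, n)) :
    'M[R[i]]_(m, n) := map_mx (real_complex R) A.

Definition reduced_svd (R : realType) (N M : nat) (A : 'M[R[i]]_N)
    (U : 'M[R[i]]_(N, M)) (Sigma : 'M[R]_M) (V : 'M[R[i]]_(N, M)) : Prop :=
  [/\ is_diag_mx Sigma, posdefmx Sigma,
      U ^t* *m U = 1%:M, V ^t* *m V = 1%:M
    & A = U *m complexmx Sigma *m V ^t*].

Definition Smx (R : realType) (N M : nat) (U : 'M[R[i]]_(N, M))
    (Sigma : 'M[R]_M) (V : 'M[R[i]]_(N, M)) (A : 'M[R[i]]_N) : 'M[R[i]]_M :=
  U ^t* *m A *m V *m invmx (complexmx Sigma).

(* Main.v *)
Require Import Defs.
From mathcomp Require Import ring lra.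

Set Implicit Arguments.
Unset Strict Implicit.
Unset Printing Implicit Defensive.

(** With the Vandermonde matrix A = (z_j^k), rows indexed by the grid k and
    columns by the nodes j, and D = diag(c_j), the data matrices factor as
    T = A D A^* and T_l = A D Z_l A^* with Z_l = diag(<z_j, e_l>) ([TmxE],
    [TshiftE]).

    The algebraic half only uses this factorisation.  If T = U Sigma V^*, put
    P = U^* A and Q = D A^* V Sigma^-1.  Then P Q = U^* T V Sigma^-1 = 1, so
    Q = P^-1, and as D and Z_l commute, S_l = P Z_l P^-1 ([Smx_similar]).
    If W also diagonalizes every S_l, then X = P^-1 W intertwines Z_l with
    the diagonal matrix W^-1 S_l W.  Some product in the Leibniz expansion of
    det X is nonzero, and it yields a permutation tau with X_{tau j, j} != 0
    for all j; comparing entries at (tau j, j) identifies the j-th diagonal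
    entry, with the same tau for every l ([simultaneous_diag_eigenvalues]).

    The analytic half is that A has rank M, i.e. that
    sum_j v_j z_j^k = 0 for all k in the grid forces v = 0
    ([separated_monomials_free]).  Let |v_j0| be maximal and test the relation
    on the polynomial prod_l g(z_l / z_{j0,l}), where g is the fourth power of
    the average of 1, u, ..., u^(m-1), with m about n/4.  It equals 1 at z_j0,
    so v_j0 = 0 as soon as the absolute values at the other nodes add up to
    less than 1 ([dominant_term_eq0]).  On the unit circle the average is at
    most 1 and at most 2/(m |1 - u|) in absolute value; the fourth power is
    therefore bounded by the product of two inverse squares, one in
    Re (1 - u) and one in Im (1 - u).
    Thus the sum over the nodes is a sum of product weights over separated
    points of a real space of dimension 2d.  Cutting each axis into cells of
    length delta puts at most one node into each box and none but z_j0 into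
    the boxes that touch the origin, so the sum is at most
    (2 + 4 kappa)^(2d) - 2^(2d) with kappa = (2/(m delta))^2
    ([separated_sum_le]).  This is below 1 once m delta is large in terms of d,
    that is once n times the separation is large. *)

(** * Sums of product weights over separated points *)

Lemma sum_inv_sqr_le2 (R : realFieldType) (n : nat) :
  \sum_(a < n) (a.+1%:R ^+ 2)^-1 <= 2 :> R.
Proof.
case: n => [|n]; first by rewrite big_ord0.
(* telescoping bound 1/(a+1)^2 <= 1/a - 1/(a+1) *)
suff: \sum_(a < n.+1) (a.+1%:R ^+ 2)^-1 <= 2 - n.+1%:R^-1 :> R.
  by move/le_trans; apply; rewrite lerBlDr lerDl invr_ge0.
elim: n => [|n IHn]; first by rewrite big_ord_recl big_ord0 expr1n invr1; lra.
rewrite big_ord_recr /=.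
apply: le_trans (lerD IHn (lexx _)) _.
rewrite (natrD _ 1 n.+1).
have : 0 < n.+1%:R :> R by rewrite ltr0n.
move: (n.+1%:R : R) => y y0.
rewrite -subr_ge0.
have -> : 2 - (1%:R + y)^-1 - (2 - y^-1 + ((1%:R + y) ^+ 2)^-1) =
   (y * (1 + y) ^+ 2)^-1.
  by field; rewrite !lt0r_neq0 //; lra.
by rewrite invr_ge0 mulr_ge0 ?sqr_ge0 // ltW.
Qed.

(** Cell number a is the set of reals of absolute value in
    [a delta, (a + 1) delta); off the cell a = 0, a weight that decays like
    kappa (delta / x)^2 is at most kappa / a^2. *)
Definition cell_weight (R : realFieldType) (kappa : R) (a : nat) : R :=
  if a is 0 then 1 else kappa / a%:R ^+ 2.

(** The boolean is the sign of the coordinate, so the two cells with a = 0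
    contribute 2. *)
Lemma sum_cell_weight (R : realFieldType) (kappa : R) (L : nat) : 0 <= kappa ->
  \sum_(p : bool * 'I_L.+1) cell_weight kappa p.2 <= 2 + 4 * kappa.
Proof.
move=> k0.
rewrite -(pair_bigA _ (fun (b : bool) (a : 'I_L.+1) => cell_weight kappa a)) /=.
rewrite big_bool /= big_ord_recl /=.
under eq_bigr do rewrite /bump /= add1n.
rewrite -mulr_sumr.
have := ler_wpM2l k0 (sum_inv_sqr_le2 R L); lra.
Qed.

(** For kappa = 0 the weight is the indicator of the two cells next to the
    origin; its sum is what the cells next to the origin contribute. *)
Lemma sum_cell_weight0 (R : realFieldType) (L : nat) :
  \sum_(p : bool * 'I_L.+1) cell_weight 0 p.2 = 2 :> R.
Proof.
rewrite -(pair_bigA _ (fun (b : bool) (a : 'I_L.+1) => cell_weight 0 a)) /=.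
rewrite big_bool /= big_ord_recl /= big1 ?addr0 // => a _.
by rewrite mul0r.
Qed.

Lemma cell_weight_ge (R : realType) (delta kappa x w : R) :
  0 < delta -> 0 <= kappa -> w <= 1 -> w * x ^+ 2 <= kappa * delta ^+ 2 ->
  w <= cell_weight kappa (Num.truncn (`|x| / delta)).
Proof.
move=> d0 k0 w1 wx.
have x0 : 0 <= `|x| / delta by rewrite divr_ge0 // ltW.
case E : (Num.truncn _) => [|a] //=.
have [w0|w0] := leP w 0; first by apply: le_trans w0 _; rewrite divr_ge0 ?sqr_ge0.
have := truncn_le (`|x| / delta); rewrite x0 E ler_pdivlMr // => ax.
rewrite ler_pdivlMr ?exprn_gt0 ?ltr0n //.
rewrite -(ler_pM2r (exprn_gt0 2 d0)) -mulrA -exprMn.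
apply: le_trans wx; rewrite ler_wpM2l ?(ltW w0) //.
by rewrite -(real_normK (num_real x)) lerXn2r ?nnegrE // mulr_ge0 ?ltW.
Qed.

Lemma same_cell_close (R : realType) (delta x y : R) : 0 < delta ->
  (0 <= x) = (0 <= y) ->
  Num.truncn (`|x| / delta) = Num.truncn (`|y| / delta) -> `|x - y| < delta.
Proof.
move=> d0 sxy txy.
have b (z : R) : (Num.truncn (`|z| / delta))%:R * delta <= `|z|
           < (Num.truncn (`|z| / delta))%:R * delta + delta.
  have z0 : 0 <= `|z| / delta by rewrite divr_ge0 // ltW.
  have := truncn_itv (R := R) z0; rewrite ler_pdivlMr // ltr_pdivrMr //.
  by rewrite -natr1 mulrDl mul1r.
have /andP[] := b x; have /andP[] := b y; rewrite txy.
move: (_%:R * delta) => c y1 y2 x1 x2; rewrite ltr_norml.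
case: (leP 0 x) sxy => x0; case: (leP 0 y) => y0 // _;
  rewrite ?(ger0_norm x0) ?(ltr0_norm x0) ?(ger0_norm y0) ?(ltr0_norm y0) in x1 x2 y1 y2;
  by apply/andP; split; lra.
Qed.

(** The cells of its coordinates determine a point, and a product weight
    summed over all boxes is a power of its one-dimensional sum.  As no point
    lies in one of the 2^#|I| boxes at the origin, these are subtracted. *)
Lemma separated_sum_le (R : realType) (I J : finType) (P : pred J)
    (x w : J -> I -> R) (delta kappa : R) :
  0 < delta -> 0 <= kappa ->
  (forall j i, 0 <= w j i <= 1) ->
  (forall j i, w j i * x j i ^+ 2 <= kappa * delta ^+ 2) ->
  (forall j k, P j -> P k -> (forall i, `|x j i - x k i| < delta) -> j = k) ->
  (forall j, P j -> exists i, delta <= `|x j i|) ->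
  \sum_(j | P j) \prod_i w j i <= (2 + 4 * kappa) ^+ #|I| - 2 ^+ #|I|.
Proof.
move=> d0 k0 w01 wx sep far.
pose cellnum j i := Num.truncn (`|x j i| / delta).
pose L := (\max_j \max_i cellnum j i)%N.
have leL j i : (cellnum j i < L.+1)%N.
  rewrite ltnS; apply: leq_trans (leq_bigmax j).
  exact: (leq_bigmax (F := cellnum j) i).
pose cell j : {ffun I -> bool * 'I_L.+1} := [ffun i => (0 <= x j i, Ordinal (leL j i))].
pose wt k (g : {ffun I -> bool * 'I_L.+1}) : R := \prod_i cell_weight k (g i).2.
have sum_wt k : \sum_g wt k g = (\sum_(p : bool * 'I_L.+1) cell_weight k p.2) ^+ #|I|.
  rewrite /wt -(bigA_distr_bigA (fun=> fun p : bool * 'I_L.+1 => cell_weight k p.2)).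
  by rewrite prodr_const.
have wt_ge g : wt 0 g <= wt kappa g.
  apply: ler_prod => i _; case: (g i).2 => -[|a] /= _; first by rewrite ler01 lexx.
  by rewrite mul0r lexx /= divr_ge0 ?sqr_ge0.
have wt0 j : P j -> wt 0 (cell j) = 0.
  move=> /far[i xi]; rewrite /wt (bigD1 i) //= ffunE /=.
  have : (0 < cellnum j i)%N.
    by rewrite /cellnum truncn_gt0 ler_pdivlMr // mul1r.
  by case: (cellnum j i) => // a _; rewrite /= !mul0r.
have cell_inj : {in [set j | P j] &, injective cell}.
  move=> j k; rewrite !inE => Pj Pk ejk; apply: sep => // i.
  have := congr1 (fun g : {ffun I -> bool * 'I_L.+1} => g i) ejk; rewrite !ffunE.
  by case=> sg tr; exact: same_cell_close.
(* Since wt 0 vanishes at every point, it can be subtracted from each term;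
   it then removes the boxes at the origin from the sum over all boxes. *)
apply: (@le_trans _ _ (\sum_(j | P j) (wt kappa (cell j) - wt 0 (cell j)))).
  apply: ler_sum => j Pj; rewrite wt0 // subr0; apply: ler_prod => i _.
  have /andP[w0 w1] := w01 j i.
  by rewrite w0 ffunE /=; exact: cell_weight_ge.
apply: (@le_trans _ _ (\sum_g (wt kappa g - wt 0 g))).
  have -> : \sum_(j | P j) (wt kappa (cell j) - wt 0 (cell j)) =
            \sum_(j in [set j | P j]) (wt kappa (cell j) - wt 0 (cell j)).
    by apply: eq_bigl => j; rewrite inE.
  rewrite -(big_imset (fun g => wt kappa g - wt 0 g) cell_inj) /=.
  rewrite [leRHS](bigID [in cell @: [set j | P j]]) /= lerDl sumr_ge0 // => g _.
  by rewrite subr_ge0.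
rewrite sumrB !sum_wt sum_cell_weight0 lerD2r lerXn2r ?nnegrE ?sum_cell_weight //.
  apply: sumr_ge0 => p _; case: p.2 => -[|a] //= _.
  by rewrite divr_ge0 ?sqr_ge0.
by rewrite addr_ge0 // mulr_ge0.
Qed.

Lemma expr_perturb_le (R : realFieldType) (D : nat) (e : R) : 0 <= e <= 1 ->
  (2 + e) ^+ D - 2 ^+ D <= e * 4 ^+ D.
Proof.
move=> /andP[e0 e1]; elim: D => [|D IHD]; first by rewrite !expr0; lra.
have h2 : (2 : R) ^+ D <= 4 ^+ D by rewrite lerXn2r ?nnegrE //; lra.
have p2 : 0 <= (2 : R) ^+ D by rewrite exprn_ge0.
rewrite !exprS; move: ((2 + e) ^+ D) (2 ^+ D) (4 ^+ D) IHD h2 p2 => a b c ab bc b0.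
have := ler_wpM2l (addr_ge0 (ler0n _ 2) e0) ab.
have := ler_wpM2l e0 bc.
have := ler_wpM2r (le_trans b0 bc) (ler_wpM2l e0 e1).
lra.
Qed.

(** * Full column rank of Vandermonde matrices with separated nodes *)

Local Notation normc := Normc.normc.

Lemma sqr_normc_ReIm (R : rcfType) (z : R[i]) :
  normc z ^+ 2 = complex.Re z ^+ 2 + complex.Im z ^+ 2.
Proof. by case: z => a b; rewrite sqr_sqrtr // addr_ge0 ?sqr_ge0. Qed.

Lemma normc_ge0 (R : rcfType) (z : R[i]) : 0 <= normc z.
Proof. by case: z => a b; rewrite sqrtr_ge0. Qed.

Lemma normE (R : rcfType) (z : R[i]) : `|z| = (normc z)%:C.
Proof. by []. Qed.

Definition mean_poly (F : fieldType) (m : nat) : {poly F} :=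
  m%:R^-1 *: \sum_(k < m) 'X^k.

Lemma size_mean_poly (F : fieldType) (m : nat) : (size (mean_poly F m) <= m)%N.
Proof.
apply: leq_trans (size_scale_leq _ _) _.
apply: leq_trans (size_sum _ _ _) _; apply/bigmax_leqP => k _.
by rewrite size_polyXn.
Qed.

Lemma horner_mean_poly (F : fieldType) (m : nat) (u : F) :
  (mean_poly F m).[u] = m%:R^-1 * \sum_(k < m) u ^+ k.
Proof.
by rewrite hornerZ horner_sum; under eq_bigr do rewrite hornerXn.
Qed.

Lemma mean_poly1 (F : numFieldType) (m : nat) : (0 < m)%N -> (mean_poly F m).[1] = 1.
Proof.
move=> m0; rewrite horner_mean_poly; under eq_bigr do rewrite expr1n.
by rewrite sumr_const card_ord mulVf // pnatr_eq0 -lt0n.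
Qed.

Lemma norm_mean_poly_le1 (F : numFieldType) (m : nat) (u : F) : (0 < m)%N ->
  `|u| = 1 -> `|(mean_poly F m).[u]| <= 1.
Proof.
move=> m0 u1; rewrite horner_mean_poly normrM normfV normr_nat.
rewrite ler_pdivrMl ?ltr0n // mulr1; apply: le_trans (ler_norm_sum _ _ _) _.
under eq_bigr do rewrite normrX u1 expr1n.
by rewrite sumr_const card_ord.
Qed.

(** The geometric sum is (1 - u^m) / (1 - u), with numerator at most 2. *)
Lemma norm_mean_poly_decay (F : numFieldType) (m : nat) (u : F) : (0 < m)%N ->
  `|u| = 1 -> `|(mean_poly F m).[u]| * `|1 - u| <= 2 / m%:R.
Proof.
move=> m0 u1; rewrite horner_mean_poly -normrM -mulrA [X in _ * X]mulrC.
rewrite -opprB mulNr -subrX1 normrM normfV normr_nat mulrC.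
rewrite ler_pM2r ?invr_gt0 ?ltr0n // normrN; apply: le_trans (ler_normB _ _) _.
by rewrite normrX u1 expr1n normr1.
Qed.

(** Expanding the product writes the value of the test polynomial as a
    combination of monomials with exponents in the grid. *)
Lemma sum_horner_prod_eq0 (F : fieldType) (I J : finType) (n : nat)
    (z : J -> I -> F) (b : I -> F) (v : J -> F) (p : {poly F}) :
  (size p <= n.+1)%N ->
  (forall k : {ffun I -> 'I_n.+1}, \sum_j v j * \prod_i z j i ^+ k i = 0) ->
  \sum_j v j * \prod_i p.[z j i * b i] = 0.
Proof.
move=> sp vz.
under eq_bigr => j _.
  under eq_bigr do rewrite (horner_coef_wide _ sp).
  rewrite bigA_distr_bigA mulr_sumr /=.
  over.
rewrite exchange_big big1 //= => k _.
rewrite (eq_bigr (fun j => (\prod_i (p`_(k i) * b i ^+ k i)) *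
                           (v j * \prod_i z j i ^+ k i))).
  by rewrite -mulr_sumr vz mulr0.
move=> j _; rewrite mulrCA -big_split /=; congr (_ * _); apply: eq_bigr => i _.
by rewrite exprMn mulrAC mulrA.
Qed.

(** Diagonal dominance: otherwise the term of j0 would exceed all the others
    together. *)
Lemma dominant_term_eq0 (R : rcfType) (J : finType) (v p : J -> R[i]) (j0 : J) :
  \sum_j v j * p j = 0 -> p j0 = 1 ->
  (forall j, normc (v j) <= normc (v j0)) ->
  \sum_(j | j != j0) normc (p j) < 1 -> v j0 = 0.
Proof.
move=> vp p1 vmax sp.
apply/eqP; rewrite -normr_eq0 normE; apply/eqP; congr (_%:C).
apply/eqP; rewrite eq_le normc_ge0 andbT leNgt; apply/negP => v0.
suff : normc (v j0) <= normc (v j0) * \sum_(j | j != j0) normc (p j).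
  by rewrite leNgt gtr_pMr // sp.
move: vp; rewrite (bigD1 j0) //= p1 mulr1 => /eqP; rewrite addr_eq0 => /eqP vE.
rewrite -lecR -normE [in X in X <= _]vE normrN rmorphM /= rmorph_sum /= mulr_sumr.
apply: le_trans (ler_norm_sum _ _ _) _; apply: ler_sum => j _.
by rewrite normrM ler_wpM2r // !normE lecR.
Qed.

(** With delta = K / (8 m d), this K gives 4 kappa = 4^(- 2d) / 4, so that
    (2 + 4 kappa)^(2d) - 2^(2d) <= 4 kappa 4^(2d) = 1/4. *)
Definition separation_constant (R : realFieldType) (d : nat) : R := 64 * d%:R * 4 ^+ d.

(** The separation hypothesis is squared, which avoids square roots.
    The test polynomial is centred at a node j0 where |v_j| is maximal. *)
Lemma separated_monomials_free (R : realType) (d M n : nat) (z : 'I_M -> 'I_d -> R[i])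
    (v : 'I_M -> R[i]) :
  (0 < d)%N ->
  (forall j l, `|z j l| = 1) ->
  (forall j k, j != k ->
     separation_constant R d ^+ 2 <= n%:R ^+ 2 * \sum_l normc (z j l - z k l) ^+ 2) ->
  (forall k : {ffun 'I_d -> 'I_n.+1}, \sum_j v j * \prod_l z j l ^+ k l = 0) ->
  forall j, v j = 0.
Proof.
move=> d0 z1 zsep vz j1.
pose j0 := [arg max_(j > j1) normc (v j)]%O.
have vmax j : normc (v j) <= normc (v j0).
  by rewrite /j0; case: Order.TotalTheory.arg_maxP => // i _; apply.
suff v0 : v j0 = 0.
  have := vmax j1; rewrite v0 Normc.normc0 => v1; apply: Normc.eq0_normc.
  by apply/eqP; rewrite eq_le v1 normc_ge0.
(* The kernel g has degree 4 (m - 1), which must not exceed n, and the decay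
   estimate needs m >= n / 4. *)
pose m := (n %/ 4).+1.
have m0 : (0 < m)%N by [].
have mR0 : 0 < m%:R :> R by rewrite ltr0n.
have dR0 : 0 < d%:R :> R by rewrite ltr0n.
have d4 : 0 < 4 ^+ d :> R by rewrite exprn_gt0.
have K0 : 0 < separation_constant R d by rewrite !mulr_gt0.
have nm : (n <= 4 * m)%N.
  by rewrite /m mulnS {1}(divn_eq n 4) mulnC addnC leq_add2r ltnW // ltn_mod.
pose g := mean_poly R[i] m ^+ 4.
have sg : (size g <= n.+1)%N.
  apply: leq_trans (size_poly_exp_leq _ _) _; rewrite ltnS.
  apply: (@leq_trans (n %/ 4 * 4)); last exact: leq_divM.
  by rewrite leq_mul2r -subn1 leq_subLR add1n size_mean_poly orbT.
(* The nodes are rotated so that z_j0 becomes (1, ..., 1). *)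
pose u j l := z j l * (z j0 l)^-1.
have z0 j l : z j l != 0 by rewrite -normr_eq0 z1 oner_eq0.
have u1 j l : `|u j l| = 1 by rewrite normrM normfV !z1 invr1 mulr1.
have uu j k l : normc (u j l - u k l) = normc (z j l - z k l).
  apply: complexI; rewrite -!normE /u -mulrBl normrM normfV z1.
  by rewrite invr1 mulr1.
pose rho j l := normc (mean_poly R[i] m).[u j l].
apply: (dominant_term_eq0 (sum_horner_prod_eq0 (fun l => (z j0 l)^-1) sg vz)) => //.
  by rewrite big1 // => l _; rewrite divff // horner_exp mean_poly1 // expr1n.
(* With q = K / (4 m) a lower bound for the distance of two nodes,
   delta = q / (2 d): two nodes whose 2d real coordinates all differ by less
   than delta have squared distance at most 2 d delta^2 < q^2. *)
pose delta : R := separation_constant R d / (8 * m%:R * d%:R).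
have delta0 : 0 < delta by rewrite divr_gt0 // !mulr_gt0.
pose kappa : R := (2 / (m%:R * delta)) ^+ 2.
have kappa0 : 0 <= kappa by rewrite sqr_ge0.
pose x j (a : 'I_d * bool) :=
  if a.2 then complex.Re (1 - u j a.1) else complex.Im (1 - u j a.1).
(* The fourth power of rho is shared equally by the real and the imaginary
   coordinate. *)
pose w j (a : 'I_d * bool) := rho j a.1 ^+ 2.
have near j k : (forall a, `|x j a - x k a| < delta) -> j = k.
  move=> xjk; apply/eqP; apply: contraT => /zsep; rewrite leNgt => /negP; case.
  have xsq a : (x j a - x k a) ^+ 2 <= delta ^+ 2.
    rewrite -(real_normK (num_real (_ - _))).
    by rewrite lerXn2r ?nnegrE ?normr_ge0 ?(ltW delta0) // ltW.
  have le_sum : \sum_l normc (z j l - z k l) ^+ 2 <= 2 * d%:R * delta ^+ 2.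
    apply: le_trans (_ : \sum_(l < d) (delta ^+ 2 + delta ^+ 2) <= _); last first.
      by rewrite sumr_const card_ord -[_ *+ d]mulr_natl; lra.
    apply: ler_sum => l _; rewrite -(uu j k) sqr_normc_ReIm.
    have := lerD (xsq (l, true)) (xsq (l, false)); rewrite /x /=.
    case: (u j l) => a b; case: (u k l) => a' b' /=.
    by apply: le_trans; rewrite le_eqVlt; apply/orP; left; apply/eqP; ring.
  have n2 : (n%:R : R) ^+ 2 <= (4 * m%:R) ^+ 2.
    by rewrite lerXn2r ?nnegrE ?ler0n ?mulr_ge0 // -natrM ler_nat.
  apply: (@le_lt_trans _ _ ((4 * m%:R) ^+ 2 * (2 * d%:R * delta ^+ 2))).
    by apply: ler_pM => //; rewrite ?sqr_ge0 // sumr_ge0 // => l _; rewrite sqr_ge0.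
  have -> : (4 * m%:R) ^+ 2 * (2 * d%:R * delta ^+ 2) =
            separation_constant R d ^+ 2 / (2 * d%:R).
    by rewrite /delta; field; rewrite !lt0r_neq0.
  rewrite ltr_pdivrMr ?mulr_gt0 // ltr_pMr ?exprn_gt0 //.
  by rewrite -natrM ltr1n leq_pmulr.
have -> : \sum_(j | j != j0) normc (\prod_l g.[z j l / z j0 l]) =
          \sum_(j | j != j0) \prod_a w j a.
  apply: eq_bigr => j _; apply: complexI.
  rewrite -normE normr_prod rmorph_prod /=.
  rewrite -(pair_bigA _ (fun l (_ : bool) => (rho j l ^+ 2)%:C)) /=.
  apply: eq_bigr => l _; rewrite big_bool /= -rmorphM -exprD /=.
  by rewrite horner_exp normrX rmorphXn.
apply: (@le_lt_trans _ _ ((2 + 4 * kappa) ^+ #|{: 'I_d * bool}| - 2 ^+ #|{: 'I_d * bool}|)).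
  apply: (separated_sum_le (x := x) delta0 kappa0).
  - move=> j a; rewrite /w sqr_ge0 /= expr_le1 ?normc_ge0 //.
    by rewrite -lecR -normE; apply: norm_mean_poly_le1.
  - move=> j [l b].
    have -> : kappa * delta ^+ 2 = (2 / m%:R) ^+ 2.
      by rewrite /kappa; field; rewrite !lt0r_neq0.
    apply: (@le_trans _ _ ((rho j l * normc (1 - u j l)) ^+ 2)).
      rewrite exprMn ler_wpM2l ?sqr_ge0 // sqr_normc_ReIm /x /=.
      by case: b; rewrite ?lerDl ?lerDr sqr_ge0.
    rewrite lerXn2r ?nnegrE ?mulr_ge0 ?normc_ge0 ?invr_ge0 ?(ltW mR0) //.
    rewrite -lecR rmorphM /= -!normE fmorph_div /= !rmorph_nat.
    exact: norm_mean_poly_decay.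
  - by move=> j k _ _; apply: near.
  - move=> j; have [|/existsPn xj] := boolP [exists a, delta <= `|x j a|].
      by move=> /existsP.
    case/eqP; apply: near => a; rewrite ltNge; apply: contra (xj a).
    suff -> : x j0 a = 0 by rewrite subr0.
    by rewrite /x /u divff // subrr; case: a.2.
have kE : 4 * kappa = (4 * (4 ^+ d) ^+ 2)^-1.
  by rewrite /kappa /delta /separation_constant; field; rewrite !lt0r_neq0.
have d41 : 1 <= (4 ^+ d) ^+ 2 :> R by rewrite !exprn_ege1 // ler1n.
apply: le_lt_trans (expr_perturb_le _ _) _.
  by rewrite kE invr_ge0 mulr_ge0 ?sqr_ge0 //= invf_le1; lra.
rewrite kE card_prod card_ord card_bool exprM.
have -> : (4 * (4 ^+ d) ^+ 2)^-1 * (4 ^+ d) ^+ 2 = 4^-1 :> R.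
  by field; rewrite lt0r_neq0.
lra.
Qed.

(** * Diagonalization *)

(** Some product in the Leibniz expansion of the determinant is nonzero. *)
Lemma unitmx_transversal (F : fieldType) (M : nat) (X : 'M[F]_M) :
  X \in unitmx -> exists tau : 'S_M, forall j, X (tau j) j != 0.
Proof.
rewrite -unitmx_tr unitmxE unitfE => detX.
have [tau tauP|no] := pickP (fun tau : 'S_M => [forall j, X (tau j) j != 0]).
  by exists tau; apply/forallP.
case/eqP: detX; rewrite /determinant big1 // => tau _.
have /forallPn[j] := negbT (no tau); rewrite negbK => /eqP Xj.
by rewrite (bigD1 j) //= mxE Xj mul0r mulr0.
Qed.

(** The permutation comes from the base change P^-1 W alone, so it is the same
    for all l, even when the diagonal entries of some z l coincide. *)
Lemma simultaneous_diag_eigenvalues (F : fieldType) (L : Type) (M : nat)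
    (z : L -> 'rV[F]_M) (S : L -> 'M[F]_M) (P W : 'M[F]_M) :
  P \in unitmx -> W \in unitmx ->
  (forall l, S l = P *m diag_mx (z l) *m invmx P) ->
  (forall l, is_diag_mx (invmx W *m S l *m W)) ->
  exists tau : 'S_M, forall l,
    invmx W *m S l *m W = diag_mx (\row_j z l 0 (tau j)).
Proof.
move=> Pu Wu SE diagS.
have [tau tauP] : exists tau : 'S_M, forall j, (invmx P *m W) (tau j) j != 0.
  by apply: unitmx_transversal; rewrite unitmx_mul unitmx_inv Pu.
exists tau => l; have /diag_mxP[lam lamE] := diagS l.
rewrite lamE; congr diag_mx; apply/rowP => j; rewrite mxE.
have comm : diag_mx (z l) *m (invmx P *m W) = (invmx P *m W) *m diag_mx lam.
  by rewrite -lamE SE !mulmxA mulmxK // mulVmx // mul1mx.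
move/matrixP: comm => /(_ (tau j) j).
move: (_ *m W) (tauP j) => X X0.
by rewrite mul_diag_mx mul_mx_diag !mxE mulrC => /(mulfI X0).
Qed.

Lemma posdefmx_unit (R : realType) (m : nat) (A : 'M[R]_m) :
  posdefmx A -> A \in unitmx.
Proof.
case=> _ Apos; rewrite -unitmx_tr -row_free_unit -kermx_eq0; apply: contraT => /rowV0Pn[v].
rewrite sub_kermx => /eqP vA v0.
have := Apos v^T; rewrite trmxK trmx_eq0 => /(_ v0).
by rewrite -[A]trmxK -mulmxA -trmx_mul vA trmx0 mulmx0 mxE ltxx.
Qed.

(** The base change is P = U^* A, a square matrix with right inverse
    D B V Sigma^-1, because U^* (A D B) V Sigma^-1 = 1. *)
Lemma Smx_similar (R : realType) (N M : nat) (A U V : 'M[R[i]]_(N, M))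
    (Sigma : 'M[R]_M) (D : 'M[R[i]]_M) (B : 'M[R[i]]_(M, N)) :
  reduced_svd (A *m D *m B) U Sigma V ->
  exists P : 'M[R[i]]_M, P \in unitmx /\
    forall Z : 'M[R[i]]_M, D *m Z = Z *m D ->
      Smx U Sigma V (A *m D *m Z *m B) = P *m Z *m invmx P.
Proof.
case=> _ /posdefmx_unit Sigma_unit UU VV AE.
have SCu : complexmx Sigma \in unitmx by rewrite map_unitmx.
pose P := U ^t* *m A; pose Q := D *m B *m V *m invmx (complexmx Sigma).
have PQ : P *m Q = 1%:M.
  have -> : P *m Q =
      U ^t* *m (A *m D *m B) *m V *m invmx (complexmx Sigma).
    by rewrite /P /Q !mulmxA.
  rewrite AE !mulmxA UU mul1mx.
  by rewrite -[_ *m V ^t* *m V]mulmxA VV mulmx1 mulmxV.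
have [Pu _] := mulmx1_unit PQ.
exists P; split=> // Z DZ.
have -> : invmx P = Q by rewrite -[LHS]mulmx1 -PQ mulKmx.
by rewrite /Smx -[A *m D *m Z]mulmxA DZ /P /Q !mulmxA.
Qed.

(** * Factorisation of the data matrices *)

Lemma expim2piD (R : realType) (x y : R) :
  expim2pi (x + y) = expim2pi x * expim2pi y.
Proof.
rewrite /expim2pi mulrDr cosD sinD; apply/eqP.
rewrite eq_complex /=; apply/andP; split; apply/eqP; ring.
Qed.

Lemma expim2pi0 (R : realType) : expim2pi (0 : R) = 1.
Proof. by apply/eqP; rewrite eq_complex /= mulr0 cos0 sin0 oppr0 !eqxx. Qed.

Lemma expim2piN (R : realType) (x : R) : expim2pi (- x) = (expim2pi x)^*.
Proof. by rewrite /expim2pi mulrN cosN sinN opprK; congr (_ +i* _); rewrite opprK. Qed.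

Lemma expim2pi_sum (R : realType) (I : finType) (x : I -> R) :
  expim2pi (\sum_i x i) = \prod_i expim2pi (x i).
Proof. exact: (big_morph _ (@expim2piD R) (@expim2pi0 R)). Qed.

Lemma expim2piMn (R : realType) (x : R) (n : nat) :
  expim2pi (x * n%:R) = expim2pi x ^+ n.
Proof.
elim: n => [|n IHn]; first by rewrite mulr0 expim2pi0.
by rewrite -natr1 mulrDr mulr1 expim2piD IHn exprSr.
Qed.

Lemma norm_expim2pi (R : realType) (x : R) : `|expim2pi x| = 1.
Proof. by rewrite normc_def /= sqrrN cos2Dsin2 sqrtr1. Qed.

Definition vandermonde (R : realType) (d M n : nat)
    (s : 'I_(n.+1 ^ d) -> {ffun 'I_d -> 'I_n.+1}) (t : 'I_M -> 'rV[R]_d) :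
    'M[R[i]]_(n.+1 ^ d, M) :=
  \matrix_(a, j) \prod_l expim2pi (t j 0 l) ^+ s a l.

Lemma expim2pi_gridvB (R : realType) (d n : nat) (t : 'rV[R]_d)
    (k k' : {ffun 'I_d -> 'I_n.+1}) :
  expim2pi (\sum_(l < d) t 0 l * ((gridv k - gridv k') 0 l)%:~R) =
  (\prod_l expim2pi (t 0 l) ^+ k l) * (\prod_l expim2pi (t 0 l) ^+ k' l)^*.
Proof.
under [X in expim2pi X]eq_bigr do rewrite !mxE rmorphB /= mulrBr.
rewrite sumrB expim2piD expim2piN !expim2pi_sum.
by congr (_ * _^*); apply: eq_bigr => l _; rewrite -expim2piMn.
Qed.

Lemma TmxE (R : realType) (d M n : nat)
    (s : 'I_(n.+1 ^ d) -> {ffun 'I_d -> 'I_n.+1}) (t : 'I_M -> 'rV[R]_d)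
    (c : 'I_M -> R[i]) :
  Tmx s t c = vandermonde s t *m diag_mx (\row_j c j) *m (vandermonde s t) ^t*.
Proof.
apply/matrixP => a b; rewrite mul_mx_diag !mxE; apply: eq_bigr => j _.
by rewrite expim2pi_gridvB !mxE mulrA [c j * _]mulrC.
Qed.

Lemma TshiftE (R : realType) (d M n : nat)
    (s : 'I_(n.+1 ^ d) -> {ffun 'I_d -> 'I_n.+1}) (t : 'I_M -> 'rV[R]_d)
    (c : 'I_M -> R[i]) (l : 'I_d) :
  Tshift s t c l =
  vandermonde s t *m diag_mx (\row_j c j) *m diag_mx (\row_j node (t j) 0 l)
    *m (vandermonde s t) ^t*.
Proof.
apply/matrixP => a b; rewrite !mul_mx_diag !mxE; apply: eq_bigr => j _.
have -> : \sum_(i < d) t j 0 i * ((gridv (s a) - gridv (s b) + delta_mx 0 l) 0 i)%:~R =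
    \sum_(i < d) t j 0 i * ((gridv (s a) - gridv (s b)) 0 i)%:~R + t j 0 l.
  under eq_bigr do rewrite mxE rmorphD /= mulrDr.
  rewrite big_split /=; congr (_ + _).
  rewrite (bigD1 l) //= !mxE !eqxx mulr1 big1 ?addr0 // => i il.
  by rewrite !mxE (negPf il) andbF mulr0.
rewrite expim2piD expim2pi_gridvB !mxE; ring.
Qed.

Lemma sqr_enorm (R : realType) (d : nat) (x : 'rV[R[i]]_d) :
  enorm x ^+ 2 = \sum_l normc (x 0 l) ^+ 2.
Proof.
have xx : dotmx x x = (\sum_l normc (x 0 l) ^+ 2)%:C.
  rewrite dotmxE mxE rmorph_sum; apply: eq_bigr => l _ /=.
  by rewrite !mxE rmorphXn /= -normE -normCK.
by rewrite /enorm xx sqr_sqrtr // sumr_ge0 // => l _; rewrite sqr_ge0.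
Qed.

Lemma rank_vandermonde (R : realType) (d M n : nat)
    (s : 'I_(n.+1 ^ d) -> {ffun 'I_d -> 'I_n.+1}) (t : 'I_M -> 'rV[R]_d) :
  (0 < d)%N -> bijective s ->
  (forall j k, j != k ->
     separation_constant R d <= n%:R * enorm (node (t j) - node (t k))) ->
  \rank (vandermonde s t) = M.
Proof.
move=> d0 [s' _ sK'] sep; rewrite -mxrank_tr; apply/eqP/inj_row_free => v.
move=> /rowP vA; apply/rowP => j; rewrite mxE.
apply: (separated_monomials_free (n := n) (z := fun j l => expim2pi (t j 0 l))
          (v := fun j => v 0 j)) => //.
- by move=> ? ?; exact: norm_expim2pi.
- move=> {}j k /sep Kn.
  have <- : enorm (node (t j) - node (t k)) ^+ 2 =
      \sum_l normc (expim2pi (t j 0 l) - expim2pi (t k 0 l)) ^+ 2.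
    by rewrite sqr_enorm; apply: eq_bigr => l _; rewrite !mxE.
  rewrite -exprMn lerXn2r ?nnegrE ?mulr_ge0 ?sqrtr_ge0 //.
- move=> k; have := vA (s' k); rewrite mxE [RHS]mxE => vk; rewrite -[RHS]vk.
  by apply: eq_bigr => i _; rewrite !mxE sK'.
Qed.

(** A vanishing separation would make the quotient infinite, so it is excluded
    by the hypothesis; the value +oo only occurs when there is no pair. *)
Lemma separation_bound (R : realType) (d M n : nat) (t : 'I_M -> 'rV[R]_d) (K : R) :
  0 < K -> (K%:E / separation t <= (n%:R)%:E)%E ->
  forall j k, j != k -> K <= n%:R * enorm (node (t j) - node (t k)).
Proof.
move=> K0 Kn j k jk.
have : (separation t <= (enorm (node (t j) - node (t k)))%:E)%E.
  exact: (bigmin_le_cond _ (j := (j, k))).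
have : (0 <= separation t)%E.
  by apply: le_bigmin => // p _; rewrite lee_fin sqrtr_ge0.
case: (separation t) Kn => [r||] //=.
rewrite inver; have [->|r0] := eqVneq r 0; first by rewrite gt0_muley ?lte_fin.
rewrite !lee_fin => Kn; rewrite le_eqVlt eq_sym (negPf r0) /= => rpos /(ler_wpM2l (ler0n R n)).
by apply: le_trans; rewrite -ler_pdivrMr.
Qed.

(** * The theorem *)

Theorem theorem2p1 (R : realType) (d : nat) (hd : (1 <= d)%N) :
  exists K : R, 0 < K /\
  forall (M n : nat) (hM : (1 <= M)%N)
    (s : 'I_(n.+1 ^ d) -> {ffun 'I_d -> 'I_n.+1}) (hs : bijective s)
    (t : 'I_M -> 'rV[R]_d)
    (ht01 : forall j l, 0 <= t j 0 l < 1) (htinj : injective t)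
    (c : 'I_M -> R[i]) (hc : forall j, c j != 0),
  (K%:E / separation t <= (n%:R)%:E)%E ->
  \rank (Tmx s t c) = M /\
  forall (U V : 'M[R[i]]_(n.+1 ^ d, M)) (Sigma : 'M[R]_M),
    reduced_svd (Tmx s t c) U Sigma V ->
    let S (l : 'I_d) := Smx U Sigma V (Tshift s t c l) in
    codiagonalizable [seq S l | l <- enum 'I_d] /\
    forall W : 'M[R[i]]_M, W \in unitmx ->
      (forall l : 'I_d, is_diag_mx (invmx W *m S l *m W)) ->
      exists tau : 'S_M, forall l : 'I_d,
        invmx W *m S l *m W =
        diag_mx (\row_j dotmx (node (t (tau j))) (delta_mx 0 l)).
Proof.
exists (separation_constant R d).
have K0 : 0 < separation_constant R d by rewrite !mulr_gt0 ?exprn_gt0 ?ltr0n.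
split=> // M n _ s hs t _ _ c hc Kn.
have rankA := rank_vandermonde hd hs (separation_bound K0 Kn).
split.
  rewrite TmxE -mulmxA mxrankMfree // /row_free mxrankMfree.
    rewrite mxrank_unit // unitmxE det_diag unitfE.
    by apply/prodf_neq0 => j _; rewrite mxE.
  by rewrite /row_free mxrank_map mxrank_tr rankA.
move=> U V Sigma; rewrite TmxE => /Smx_similar[P [Pu SP]] S.
pose z l := \row_j node (t j) 0 l.
have SE l : S l = P *m diag_mx (z l) *m invmx P.
  by rewrite /S TshiftE SP // diag_mxC.
split.
  exists (invmx P); first by rewrite unitmx_inv.
  apply/allP => _ /mapP[l _ ->]; rewrite /= /similar_to conjumx ?unitmx_inv //.
  by rewrite invmxK SE !mulmxA mulVmx // mul1mx mulmxKV // diag_mx_is_diag.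
move=> W Wu diagS.
have [tau tauE] := simultaneous_diag_eigenvalues Pu Wu SE diagS.
exists tau => l; rewrite tauE; congr diag_mx; apply/rowP => j; rewrite !mxE.
rewrite dotmxE mxE (bigD1 l) //= big1 ?addr0 => [|i il]; rewrite !mxE ?eqxx ?rmorph1 ?mulr1 //.
by rewrite (negPf il) andbF rmorph0 mulr0.
Qed.
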